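(* Let $\varepsilon_1,\varepsilon_2\in(0,+\infty)$. The unit distance graphs of the strips $\mathbb{R}\times[0,\varepsilon_1]$ and $\mathbb{R}\times[0,\varepsilon_2]$ (with the standard Euclidean metric of $\mathbb{R}^2$) are isomorphic as graphs if and only if $\varepsilon_1=\varepsilon_2$.
   Context: The unit distance graph of a set $V$ in a metric space is the graph with vertex set $V$ in which two vertices are joined by an edge if and only if the distance between them is exactly $1$. *)

(* Defs.v *)
From Stdlib Require Import Reals Lra FinFun.
Local Open Scope R_scope.

Record graph : Type := Graph {
  vertex : Type;
  adj : vertex -> vertex -> Prop;
  adj_sym : forall u v, adj u v -> adj v u;
  adj_irrefl : forall v, ~ adj v v
}.

Definition isomorphic (G H : graph) : Prop :=
  exists f : vertex G -> vertex H,
    Bijective f /\ forall u v, adj G u v <-> adj H (f u) (f v).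

(* Vertices carry a proof of membership in [V]; by proof irrelevance they are
   determined by the underlying point. *)
Definition unit_adj (M : Metric_Space) (V : Base M -> Prop)
    (u v : {p : Base M | V p}) : Prop :=
  dist M (proj1_sig u) (proj1_sig v) = 1.

Lemma unit_adj_sym M V u v : unit_adj M V u v -> unit_adj M V v u.
Proof. unfold unit_adj; now rewrite dist_sym. Qed.

Lemma unit_adj_irrefl M V v : ~ unit_adj M V v v.
Proof.
unfold unit_adj; rewrite (proj2 (dist_refl M _ _) eq_refl); lra.
Qed.

Definition unit_distance_graph (M : Metric_Space) (V : Base M -> Prop) : graph :=
  Graph {p : Base M | V p} (unit_adj M V) (unit_adj_sym M V)
    (unit_adj_irrefl M V).

Definition plane_dist (p q : R * R) : R :=
  dist_euc (fst p) (snd p) (fst q) (snd q).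

Lemma plane_dist_pos p q : plane_dist p q >= 0.
Proof. apply Rle_ge, sqrt_pos. Qed.

Lemma plane_dist_sym p q : plane_dist p q = plane_dist q p.
Proof. apply distance_symm. Qed.

Lemma plane_dist_refl p q : plane_dist p q = 0 <-> p = q.
Proof.
split; [|intros ->; apply distance_refl].
destruct p as [x y], q as [x' y']; unfold plane_dist, dist_euc; cbn; intros H.
apply sqrt_eq_0 in H; [|apply Rplus_le_le_0_compat; apply Rle_0_sqr].
destruct (Rplus_sqr_eq_0 _ _ H).
f_equal; lra.
Qed.

Lemma plane_dist_tri p q r : plane_dist p q <= plane_dist p r + plane_dist r q.
Proof. apply triangle. Qed.

Definition euclidean_plane : Metric_Space :=
  Build_Metric_Space (R * R) plane_dist
    plane_dist_pos plane_dist_sym plane_dist_refl plane_dist_tri.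

Definition strip (eps : R) (p : R * R) : Prop := 0 <= snd p <= eps.

(* Main.v *)
Require Import Defs.
From Stdlib Require Import Reals ZArith Lra Psatz ProofIrrelevance.
Local Open Scope R_scope.

(** Opposite sides of a rhombus whose vertices are joined by unit edges are
    parallel, and a graph isomorphism maps rhombi to rhombi.  Translating an
    edge along rhombi therefore shows that a step [(a, b)], where [b = e / n] is
    small compared with the width [e], is always mapped to the same unit vector
    [w].  Climbing [n] times by [(a, b)] stays in the strip, so [n * w_y] is at
    most the width [e'] of the target; if [e' < e] this forces [|w_y| < b], hence
    [|w_x| > a].  The zigzag alternating [(a, b)] and [(a, -b)] stays in the strip
    forever, so its image is a zigzag of horizontal speed [|w_x|].  But its points
    at horizontal distance [2ma] are joined by slightly more than [2ma] unit steps,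
    whose images cover too small a horizontal distance. *)

(** The map is total on the plane and constrained only on the strip, which spares the computations
    membership proofs. The condition is one-sided and yields [e <= e']; equality comes from an
    isomorphism and its inverse. *)
Definition unit_embedding (e e' : R) (g : R * R -> R * R) : Prop :=
  (forall p, strip e p -> strip e' (g p)) /\
  (forall p q, strip e p -> strip e q ->
     plane_dist p q = 1 -> plane_dist (g p) (g q) = 1) /\
  (forall p q, strip e p -> strip e q -> g p = g q -> p = q).

Definition displacement (g : R * R -> R * R) (u v x y : R) : R * R :=
  (fst (g (x + u, y + v)) - fst (g (x, y)),
   snd (g (x + u, y + v)) - snd (g (x, y))).

(** * Unit vectors and rhombi in the plane *)

Lemma plane_dist_1 (p q : R * R) :
  plane_dist p q = 1 <->
  (fst p - fst q) * (fst p - fst q) + (snd p - snd q) * (snd p - snd q) = 1.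
Proof.
unfold plane_dist, dist_euc, Rsqr; split; intros H.
- set (z := _ + _) in *.
  assert (0 <= z) by 
    (apply Rplus_le_le_0_compat; apply Rle_0_sqr).
  rewrite <- (sqrt_sqrt z), H by assumption; ring.
- rewrite H; apply sqrt_1.
Qed.

Lemma sqrt_1_minus_sqr (h : R) :
  h * h <= 1 -> exists s, 0 <= s /\ s * s + h * h = 1.
Proof.
intros H; exists (sqrt (1 - h * h)); split; [apply sqrt_pos|].
rewrite sqrt_sqrt; lra.
Qed.

Lemma rhombus_closes (e1 e2 g1 g2 t1 t2 : R) :
  e1 * e1 + e2 * e2 = 1 -> g1 * g1 + g2 * g2 = 1 ->
  (t1 - e1) * (t1 - e1) + (t2 - e2) * (t2 - e2) = 1 ->
  (t1 - g1) * (t1 - g1) + (t2 - g2) * (t2 - g2) = 1 ->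
  ~ (t1 = 0 /\ t2 = 0) -> ~ (e1 = g1 /\ e2 = g2) ->
  t1 = e1 + g1 /\ t2 = e2 + g2.
Proof.
intros He Hg Hte Htg Ht Heg.
(* [r = t - (e + g)] is orthogonal to both [t] and [d = e - g], which are
   orthogonal to each other. *)
set (r1 := t1 - e1 - g1); set (r2 := t2 - e2 - g2).
set (d1 := e1 - g1); set (d2 := e2 - g2).
assert (Htd : t1 * d1 + t2 * d2 = 0) by (unfold d1, d2; lra).
assert (Hrt : r1 * t1 + r2 * t2 = 0) by (unfold r1, r2; lra).
assert (Hrd : r1 * d1 + r2 * d2 = 0) by (unfold r1, r2, d1, d2 in *; lra).
assert (Hd : d1 * d1 + d2 * d2 <> 0).
{ intros H; apply Rplus_sqr_eq_0 in H; apply Heg; unfold d1, d2 in *; lra. }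
assert (Htt : t1 * t1 + t2 * t2 <> 0).
{ intros H; now apply Rplus_sqr_eq_0 in H. }
(* Lagrange's identity shows that [t] and [d], nonzero and orthogonal, are independent; Cramer's
   rule then gives [r = 0]. *)
assert (Hdet : t1 * d2 - t2 * d1 <> 0).
{ intros H.
  assert (K : (t1 * t1 + t2 * t2) * (d1 * d1 + d2 * d2)
     = (t1 * d1 + t2 * d2) * (t1 * d1 + t2 * d2)
       + (t1 * d2 - t2 * d1) * (t1 * d2 - t2 * d1)) by ring.
  rewrite Htd, H, !Rmult_0_l, Rplus_0_l in K.
  apply Rmult_integral in K; tauto. }
assert (H1 : r1 * (t1 * d2 - t2 * d1) = 0).
{ replace (_ * _) with ((r1 * t1 + r2 * t2) * d2 - (r1 * d1 + r2 * d2) * t2)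
    by ring.
  rewrite Hrt, Hrd; ring. }
assert (H2 : r2 * (t1 * d2 - t2 * d1) = 0).
{ replace (_ * _) with ((r1 * d1 + r2 * d2) * t1 - (r1 * t1 + r2 * t2) * d1)
    by ring.
  rewrite Hrt, Hrd; ring. }
apply Rmult_integral in H1; apply Rmult_integral in H2.
unfold r1, r2 in *; split; [destruct H1 | destruct H2]; lra || tauto.
Qed.

(** * Translating an edge along rhombi *)

Lemma pair_neq (x y x' y' : R) : x <> x' \/ y <> y' -> (x, y) <> (x', y').
Proof. intros H E; injection E; tauto. Qed.

Lemma embedding_neq e e' g p q :
  unit_embedding e e' g -> strip e p -> strip e q -> p <> q ->
  ~ (fst (g p) = fst (g q) /\ snd (g p) = snd (g q)).
Proof.
intros (_ & _ & Hi) Hp Hq Hpq [H1 H2]; apply Hpq, Hi; auto.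
now apply injective_projections.
Qed.

Lemma embedding_adj e e' g p q :
  unit_embedding e e' g -> strip e p -> strip e q ->
  (fst p - fst q) * (fst p - fst q) + (snd p - snd q) * (snd p - snd q) = 1 ->
  (fst (g p) - fst (g q)) * (fst (g p) - fst (g q))
    + (snd (g p) - snd (g q)) * (snd (g p) - snd (g q)) = 1.
Proof.
intros (_ & Hd & _) Hp Hq H; apply plane_dist_1, Hd; auto.
now apply plane_dist_1.
Qed.

(** [A], [B], [C], [D] form a rhombus with sides [(u, v)] and [(s, h)]. Since [h * h <> v * v],
    opposite vertices differ in height, so by injectivity [rhombus_closes] applies to their
    images. *)
Lemma displacement_step e e' g u v s h x y :
  unit_embedding e e' g -> u * u + v * v = 1 -> s * s + h * h = 1 ->
  h * h <> v * v -> 0 <= v -> 0 <= y -> y + v <= e ->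
  0 <= y + h -> y + h + v <= e ->
  displacement g u v x y = displacement g u v (x + s) (y + h).
Proof.
intros Hg Hu Hs Hhv Hv Hy1 Hy2 Hy3 Hy4.
set (A := (x, y)); set (B := (x + u, y + v)).
set (D := (x + s, y + h)); set (C := (x + s + u, y + h + v)).
assert (SA : strip e A) by (unfold strip, A; simpl; lra).
assert (SB : strip e B) by (unfold strip, B; simpl; lra).
assert (SC : strip e C) by (unfold strip, C; simpl; lra).
assert (SD : strip e D) by (unfold strip, D; simpl; lra).
assert (NAC : C <> A) by (apply pair_neq; right; intros H; apply Hhv; nra).
assert (NBD : B <> D) by (apply pair_neq; right; intros H; apply Hhv; nra).
apply (embedding_neq _ _ _ _ _ Hg SC SA) in NAC.
apply (embedding_neq _ _ _ _ _ Hg SB SD) in NBD.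
assert (AB := embedding_adj _ _ _ B A Hg SB SA).
assert (CB := embedding_adj _ _ _ C B Hg SC SB).
assert (CD := embedding_adj _ _ _ C D Hg SC SD).
assert (DA := embedding_adj _ _ _ D A Hg SD SA).
unfold displacement; fold A B C D.
destruct (rhombus_closes (fst (g B) - fst (g A)) (snd (g B) - snd (g A))
            (fst (g D) - fst (g A)) (snd (g D) - snd (g A))
            (fst (g C) - fst (g A)) (snd (g C) - snd (g A))) as [E1 E2].
- apply AB; unfold A, B; simpl; lra.
- apply DA; unfold A, D; simpl; lra.
- rewrite <- CB by (unfold C, B; simpl; lra); ring.
- rewrite <- CD by (unfold C, D; simpl; lra); ring.
- intros [H1 H2]; apply NAC; lra.
- intros [H1 H2]; apply NBD; lra.
- f_equal; lra.
Qed.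

(** Unit steps of height [v / 2] up and [v / 2] down lead from the two base points to the same point
    [(x + s, y + v / 2)]. *)
Lemma displacement_up e e' g u v x y :
  unit_embedding e e' g -> u * u + v * v = 1 -> 0 < v -> 0 <= y ->
  y + v + v <= e ->
  displacement g u v x y = displacement g u v x (y + v).
Proof.
intros Hg Hu Hv Hy1 Hy2.
destruct (sqrt_1_minus_sqr (v / 2)) as (s & _ & Hs); [nra|].
rewrite (displacement_step e e' g u v s (v / 2) x y); [|(assumption || nra)..].
rewrite (displacement_step e e' g u v s (- (v / 2)) x (y + v));
  [|(assumption || nra)..].
f_equal; lra.
Qed.

(* A translation by [a] is one by [1 + a], made of two steps of slope below that
   of [(u, v)], followed by one by [-1]. *)
Lemma displacement_right e e' g u v a x :
  unit_embedding e e' g -> u * u + v * v = 1 -> 0 < v -> v + v <= e ->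
  0 <= a -> a * a = u * u ->
  displacement g u v x 0 = displacement g u v (x + a) 0.
Proof.
intros Hg Hu Hv Hve Ha Hau.
assert (Ha1 : a < 1) by nra.
destruct (sqrt_1_minus_sqr ((1 + a) / 2)) as (h & Hh0 & Hh); [nra|].
assert (Hhv : h < v) by nra.
rewrite (displacement_step e e' g u v ((1 + a) / 2) h x 0);
  [|(assumption || nra)..].
rewrite (displacement_step e e' g u v ((1 + a) / 2) (- h));
  [|(assumption || nra)..].
rewrite (displacement_step e e' g u v 1 0 (x + a));
  [|(assumption || nra)..].
f_equal; lra.
Qed.

(** Only [a * a = u * u] links [a] to [u], so that both edges [(a, b)] and [(- a, b)] of the zigzag
    are covered. *)
Lemma displacement_horizontal e e' g u v a (k : nat) :
  unit_embedding e e' g -> u * u + v * v = 1 -> 0 < v -> v + v <= e ->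
  0 <= a -> a * a = u * u ->
  displacement g u v (INR k * a) 0 = displacement g u v 0 0.
Proof.
intros Hg Hu Hv Hve Ha Hau; induction k as [|k IH].
- simpl; f_equal; ring.
- rewrite <- IH, (displacement_right e e' g u v a (INR k * a)); auto.
  rewrite S_INR; f_equal; ring.
Qed.

Lemma displacement_diagonal e e' g a b (k : nat) :
  unit_embedding e e' g -> a * a + b * b = 1 -> 0 < b -> b + b <= e ->
  0 <= a -> INR (S k) * b <= e ->
  displacement g a b (INR k * a) (INR k * b) = displacement g a b 0 0.
Proof.
intros Hg Hu Hb Hbe Ha Hk.
(* The base point moves along the bottom edge to abscissa [k a], then vertically by [b] at a
   time. *)
rewrite <- (displacement_horizontal e e' g a b a k); auto.
assert (H : forall j x, INR (S j) * b <= e ->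
  displacement g a b x (INR j * b) = displacement g a b x 0).
{ intros j x; induction j as [|j IH]; intros Hj.
  - simpl; f_equal; ring.
  - rewrite !S_INR in *.
    assert (0 <= INR j * b) by (apply Rmult_le_pos; [apply pos_INR|lra]).
    rewrite <- IH, (displacement_up e e' g a b x (INR j * b)); auto; try lra.
    f_equal; ring. }
now apply H.
Qed.

(** * Images of climbs and zigzags *)

Lemma climb e e' g a b (n : nat) :
  unit_embedding e e' g -> a * a + b * b = 1 -> 0 < b -> b + b <= e ->
  0 <= a -> INR n * b <= e ->
  snd (g (INR n * a, INR n * b))
    = snd (g (0, 0)) + INR n * snd (displacement g a b 0 0).
Proof.
intros Hg Hu Hb Hbe Ha; induction n as [|n IH]; intros Hn.
- simpl; rewrite !Rmult_0_l; ring.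
- pose proof (displacement_diagonal e e' g a b n Hg Hu Hb Hbe Ha Hn) as H.
  rewrite S_INR in *; rewrite <- H at 1; unfold displacement at 1; simpl.
  replace ((INR n + 1) * a) with (INR n * a + a) by ring.
  replace ((INR n + 1) * b) with (INR n * b + b) by ring.
  assert (IH' := IH ltac:(lra)); rewrite <- H in IH'.
  unfold displacement in IH'; simpl in IH'; lra.
Qed.

(** Each period is a step [(a, b)] followed by [(a, -b)]. The latter is the reverse of the step
    [(- a, b)] based at the end of the period, hence the minus sign before [w']. *)
Lemma zigzag e e' g a b (k : nat) :
  unit_embedding e e' g -> a * a + b * b = 1 -> 0 < b -> b + b <= e ->
  0 <= a ->
  let w := displacement g a b 0 0 in
  let w' := displacement g (- a) b 0 0 in
  fst (g (2 * INR k * a, 0)) = fst (g (0, 0)) + INR k * (fst w - fst w') /\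
  snd (g (2 * INR k * a, 0)) = snd (g (0, 0)) + INR k * (snd w - snd w').
Proof.
intros Hg Hu Hb Hbe Ha w w'; induction k as [|k [IH1 IH2]].
- simpl; rewrite Rmult_0_r, !Rmult_0_l; split; ring.
- assert (H1 : displacement g a b (INR (2 * k) * a) 0 = w)
    by (apply (displacement_horizontal e e'); auto).
  assert (H2 : displacement g (- a) b (INR (2 * k + 2) * a) 0 = w')
    by (apply (displacement_horizontal e e'); auto; lra).
  rewrite plus_INR, mult_INR in *; simpl (INR 2) in *.
  unfold displacement in H1, H2.
  replace (((1 + 1) * INR k + (1 + 1)) * a + - a) with ((1 + 1) * INR k * a + a)
    in H2 by ring.
  rewrite S_INR.
  replace (((1 + 1) * INR k + (1 + 1)) * a) with (2 * (INR k + 1) * a) in H2 by ring.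
  replace ((1 + 1) * INR k * a) with (2 * INR k * a) in H1, H2 by ring.
  rewrite <- H1, <- H2 in *; simpl in *; split; lra.
Qed.

(** A path of [2 N] unit steps, alternately [(c, h)] and [(c, -h)], joins the two points, and the
    image of each step changes the abscissa by at most 1. *)
Lemma short_path e e' g c h (N : nat) :
  unit_embedding e e' g -> c * c + h * h = 1 -> 0 <= h <= e ->
  Rabs (fst (g (2 * INR N * c, 0)) - fst (g (0, 0))) <= 2 * INR N.
Proof.
intros Hg Hc Hh; induction N as [|N IH].
- simpl; rewrite Rmult_0_r, Rmult_0_l, Rminus_diag, Rabs_R0; lra.
- rewrite S_INR.
  set (P := (2 * INR N * c, 0)) in *.
  set (Q := (2 * INR N * c + c, h)).
  set (T := (2 * (INR N + 1) * c, 0)).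
  assert (SP : strip e P) by (unfold strip, P; simpl; lra).
  assert (SQ : strip e Q) by (unfold strip, Q; simpl; lra).
  assert (ST : strip e T) by (unfold strip, T; simpl; lra).
  assert (PQ := embedding_adj _ _ _ Q P Hg SQ SP).
  assert (QT := embedding_adj _ _ _ T Q Hg ST SQ).
  specialize (PQ ltac:(unfold P, Q; simpl; nra)).
  specialize (QT ltac:(unfold T, Q; simpl; nra)).
  assert (K : forall s t, s * s + t * t = 1 -> Rabs s <= 1)
    by (intros s t Hst; apply Rabs_le; nra).
  apply K in PQ; apply K in QT.
  replace (fst (g T) - fst (g (0, 0))) with
    ((fst (g T) - fst (g Q)) + ((fst (g Q) - fst (g P))
      + (fst (g P) - fst (g (0, 0))))) by ring.
  eapply Rle_trans; [apply Rabs_triang|].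
  assert (M := Rabs_triang (fst (g Q) - fst (g P)) (fst (g P) - fst (g (0, 0)))).
  lra.
Qed.

(** * Comparison of the widths *)

Lemma nat_ceiling (x : R) : 0 <= x -> exists n : nat, x < INR n <= x + 1.
Proof.
intros Hx; destruct (archimed x) as [H1 H2].
exists (Z.to_nat (up x)); rewrite INR_IZR_INZ, Z2Nat.id; [lra|].
apply le_IZR; lra.
Qed.

Lemma bounded_multiples_zero (t M : R) :
  (forall k : nat, INR k * t <= M) -> t <= 0.
Proof.
intros H; destruct (Rle_or_lt t 0) as [|Ht]; [assumption|].
destruct (INR_unbounded (M / t)) as [k Hk].
specialize (H k); apply Rmult_lt_compat_r with (r := t) in Hk; [|assumption].
unfold Rdiv in Hk; rewrite Rmult_assoc, Rinv_l in Hk; lra.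
Qed.

Lemma embedding_width e e' g : 0 < e -> unit_embedding e e' g -> e <= e'.
Proof.
intros He Hg; destruct (Rle_or_lt e e') as [|Hlt]; [assumption|exfalso].
(* [n > e] gives [b < 1], and [n > 2] gives [b + b <= e]. *)
destruct (INR_unbounded (e + 2)) as [n Hn].
set (b := e / INR n).
assert (Hnb : INR n * b = e) by (unfold b; field; lra).
assert (Hb : 0 < b) by (apply Rdiv_lt_0_compat; lra).
assert (Hb1 : b < 1) by nra.
assert (Hbe : b + b <= e) by nra.
destruct (sqrt_1_minus_sqr b) as (a & Ha0 & Hab); [nra|].
assert (Ha : 0 < a) by nra.
assert (Srange : forall x y, 0 <= y <= e -> 0 <= snd (g (x, y)) <= e').
{ intros x y Hy; apply (proj1 Hg); exact Hy. }
set (w := displacement g a b 0 0).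
set (w' := displacement g (- a) b 0 0).
assert (S0 : strip e (0, 0)) by (unfold strip; simpl; lra).
assert (SW : strip e (0 + a, 0 + b)) by (unfold strip; simpl; lra).
assert (SW' : strip e (0 + - a, 0 + b)) by (unfold strip; simpl; lra).
assert (Uw : fst w * fst w + snd w * snd w = 1)
  by (apply (embedding_adj e e' g (0 + a, 0 + b) (0, 0)); auto; simpl; lra).
assert (Uw' : fst w' * fst w' + snd w' * snd w' = 1)
  by (apply (embedding_adj e e' g (0 + - a, 0 + b) (0, 0)); auto; simpl; lra).
assert (Nw : ~ (fst w = fst w' /\ snd w = snd w')).
{ assert (H : (0 + a, 0 + b) <> (0 + - a, 0 + b)) by (apply pair_neq; lra).
  apply (embedding_neq e e' g _ _ Hg SW SW') in H.
  intros [H1 H2]; apply H; unfold w, w', displacement in H1, H2; simpl in H1, H2.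
  split; lra. }
assert (Hr0 := Srange 0 0 ltac:(lra)).
assert (Hz := fun k => zigzag e e' g a b k Hg Hab Hb Hbe Ha0).
cbv zeta in Hz; fold w w' in Hz.
(* The image of the zigzag gains height [snd w - snd w'] per period; in a strip of bounded height
   this drift must vanish. *)
assert (Hy : snd w = snd w').
{ apply Rle_antisym.
  - enough (snd w - snd w' <= 0) by lra.
    apply (bounded_multiples_zero _ e'); intros k; destruct (Hz k) as [_ Hk].
    assert (HR := Srange (2 * INR k * a) 0 ltac:(lra)); lra.
  - enough (snd w' - snd w <= 0) by lra.
    apply (bounded_multiples_zero _ e'); intros k; destruct (Hz k) as [_ Hk].
    assert (HR := Srange (2 * INR k * a) 0 ltac:(lra)); lra. }
(* Unit vectors of equal height are equal or mirror images; [Nw] excludes equality. *)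
assert (Hx : fst w' = - fst w).
{ assert (H : (fst w' - fst w) * (fst w' + fst w) = 0)
    by (rewrite Hy in Uw; lra).
  apply Rmult_integral in H; destruct H; [exfalso; apply Nw; lra | lra]. }
assert (Hwb : Rabs (snd w) < b).
{ assert (C := climb e e' g a b n Hg Hab Hb Hbe Ha0 ltac:(lra)); fold w in C.
  rewrite Hnb in C.
  assert (HR := Srange (INR n * a) e ltac:(lra)).
  apply Rabs_def1; apply Rmult_lt_reg_l with (INR n); lra. }
assert (Hwa : a < Rabs (fst w)).
{ assert (H1 := Rabs_pos (fst w)); assert (H2 := Rabs_pos (snd w)).
  assert (E1 : Rabs (fst w) * Rabs (fst w) = fst w * fst w)
    by (rewrite <- Rabs_mult; apply Rabs_pos_eq; nra).
  assert (E2 : Rabs (snd w) * Rabs (snd w) = snd w * snd w)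
    by (rewrite <- Rabs_mult; apply Rabs_pos_eq; nra).
  nra. }
assert (Hw1 : Rabs (fst w) <= 1) by (apply Rabs_le; nra).
(* For this [m] the interval from [m a] to [m |fst w|] is longer than 1, so it contains an integer
   [N]. *)
destruct (INR_unbounded (1 / (Rabs (fst w) - a))) as [m Hm].
assert (Hm' : 1 < INR m * (Rabs (fst w) - a)).
{ apply Rmult_lt_compat_r with (r := Rabs (fst w) - a) in Hm; [|lra].
  unfold Rdiv in Hm; rewrite Rmult_assoc, Rinv_l in Hm; lra. }
assert (Hm0 : 0 < INR m) by nra.
destruct (nat_ceiling (INR m * a)) as [N [HN1 HN2]]; [nra|].
assert (HN : INR N < INR m * Rabs (fst w)) by lra.
assert (HN0 : 0 < INR N) by nra.
(* With this [c], [2 N] steps end exactly at abscissa [2 m a]. [N > m a] gives [c < 1]; [N <= m]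
   gives [a <= c], so the step height [h] is at most [b] and fits in the strip. *)
set (c := INR m * a / INR N).
assert (Hc : INR N * c = INR m * a) by (unfold c; field; lra).
assert (Hc1 : c < 1) by (apply Rmult_lt_reg_l with (INR N); lra).
assert (HNm : INR N <= INR m) by nra.
assert (Hca : a <= c) by (apply Rmult_le_reg_l with (INR N); nra).
destruct (sqrt_1_minus_sqr c) as (h & Hh0 & Hh); [nra|].
assert (P := short_path e e' g c h N Hg ltac:(lra) ltac:(nra)).
(* The zigzag puts the images of the endpoints [2 m |fst w|] apart horizontally, which exceeds the
   bound [2 N] in [P]. *)
destruct (Hz m) as [Zm _].
rewrite Rmult_assoc, Hc, <- Rmult_assoc, Zm, Hx in P.
replace (fst (g (0, 0)) + INR m * (fst w - - fst w) - fst (g (0, 0)))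
  with (2 * INR m * fst w) in P by ring.
rewrite Rabs_mult, (Rabs_pos_eq (2 * INR m)) in P; lra.
Qed.

(** * From graph isomorphisms to embeddings *)

Lemma isomorphic_sym (G H : graph) : isomorphic G H -> isomorphic H G.
Proof.
intros (f & (f' & Hf'f & Hff') & Hadj); exists f'; split.
- exists f; auto.
- intros u v; rewrite Hadj, !Hff'; reflexivity.
Qed.

Lemma isomorphic_refl (G : graph) : isomorphic G G.
Proof. exists (fun v => v); split; [exists (fun v => v); auto | tauto]. Qed.

Lemma clamp_in_strip (e : R) (p : R * R) :
  0 < e -> strip e (fst p, Rmax 0 (Rmin (snd p) e)).
Proof.
intros He; unfold strip; simpl; split; [apply Rmax_l|].
apply Rmax_lub; [lra | apply Rmin_r].
Qed.

Lemma isomorphic_strips_le (e e' : R) : 0 < e ->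
  isomorphic (unit_distance_graph euclidean_plane (strip e))
             (unit_distance_graph euclidean_plane (strip e')) -> e <= e'.
Proof.
intros He (f & (f' & Hf'f & _) & Hadj); simpl in *.
(* Clamping the ordinate into [0, e] extends [f] to the whole plane. *)
set (r := fun p : R * R =>
  exist (strip e) (fst p, Rmax 0 (Rmin (snd p) e)) (clamp_in_strip e p He)).
assert (Hr : forall p, strip e p -> proj1_sig (r p) = p).
{ intros [x y] [H1 H2]; simpl in *.
  rewrite Rmin_left, Rmax_right by assumption; reflexivity. }
apply (embedding_width e e' (fun p => proj1_sig (f (r p))) He); repeat split.
- apply (proj2_sig (f (r p))).
- apply (proj2_sig (f (r p))).
- intros p q Hp Hq Hpq; apply (proj1 (Hadj (r p) (r q))).
  unfold unit_adj; rewrite !Hr; assumption.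
- intros p q Hp Hq Hpq.
  assert (E : f (r p) = f (r q)).
  { destruct (f (r p)) as [s Hs], (f (r q)) as [t Ht]; simpl in Hpq.
    subst t; f_equal; apply proof_irrelevance. }
  rewrite <- (Hr p), <- (Hr q), <- (Hf'f (r p)), E, Hf'f by assumption.
  reflexivity.
Qed.

Theorem theorem1 (eps1 eps2 : R) (Heps1 : 0 < eps1) (Heps2 : 0 < eps2) :
  isomorphic (unit_distance_graph euclidean_plane (strip eps1))
             (unit_distance_graph euclidean_plane (strip eps2))
  <-> eps1 = eps2.
Proof.
split.
- intros H; apply Rle_antisym; apply isomorphic_strips_le; auto.
  now apply isomorphic_sym.
- intros ->; apply isomorphic_refl.
Qed.
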